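(* Let $S$ be a special numerical semigroup which is neither irreducible nor ordinary. Then $\{s\in\mathbb{N}\mid \operatorname{m}(S)\le s<\operatorname{F}(S)\}\subseteq S$.
   Context: $\mathbb{N}=\{0,1,2,\ldots\}$. A numerical semigroup is a submonoid $S$ of $(\mathbb{N},+)$ with $\mathbb{N}\setminus S$ finite. $\operatorname{H}(S)=\mathbb{N}\setminus S$; $\operatorname{F}(S)=\max\operatorname{H}(S)$ (Frobenius number, $\operatorname{F}(\mathbb{N})=-1$); $\operatorname{m}(S)=\min(S\setminus\{0\})$. The set of special gaps is $\operatorname{SG}(S)=\{h\in\operatorname{H}(S)\mid 2h\in S \text{ and } h+s\in S \text{ for all } s\in S\setminus\{0\}\}$. $S$ is special if there is no $h\in\operatorname{SG}(S)\setminus\{\operatorname{F}(S)\}$ with $h>\operatorname{m}(S)$. $S$ is irreducible if it cannot be written as the intersection of two numerical semigroups properly containing $S$. $S$ is ordinary if $S=\{0\}\cup\{x\in\mathbb{N}\mid x\ge c\}$ for some $c\in\mathbb{N}$. *)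

(* Defs.v *)
From mathcomp Require Import all_boot all_order all_algebra.
From mathcomp Require Import all_classical.

Set Implicit Arguments.
Unset Strict Implicit.
Unset Printing Implicit Defensive.

Local Open Scope classical_set_scope.

Definition numerical_semigroup (S : set nat) : Prop :=
  [/\ S 0, (forall x y : nat, S x -> S y -> S (x + y)) & cofinite_set S].

Definition gaps (S : set nat) : set nat := ~` S.

(* [A `&` ubound A] (resp. [A `&` lbound A]) contains the maximum (resp.
   minimum) of [A], if it exists, and nothing else; [xget] returns it, or its
   first argument if there is none. The Frobenius number is an integer, so that
   it is -1 when [S] has no gap. *)
Definition frobenius (S : set nat) : int :=
  let H := Posz @` gaps S in xget (- 1)%R (H `&` ubound H).

Definition multiplicity (S : set nat) : nat :=
  let P := S `\ 0 in xget 0 (P `&` lbound P).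

Definition special_gaps (S : set nat) : set nat :=
  [set h | [/\ gaps S h, S (2 * h)
             & forall s : nat, (S `\ 0) s -> S (h + s)]].

Definition special (S : set nat) : Prop :=
  ~ exists h : nat, [/\ special_gaps S h, (h%:Z <> frobenius S)%R
                      & multiplicity S < h].

Definition irreducible (S : set nat) : Prop :=
  ~ exists A B : set nat,
      [/\ numerical_semigroup A, numerical_semigroup B,
          S `<` A, S `<` B & S = A `&` B].

Definition ordinary (S : set nat) : Prop :=
  exists c : nat, S = [set 0] `|` [set x | c <= x].

(* Main.v *)
(** A non-irreducible [S] has a special gap [h <> F], and [h < m] because [S] is
    special. As [F - h] is a gap too, it suffices to see that no two gaps
    [x + y = F] with [x <> y] satisfy [m < x]: this gives [F - h < m], hence
    [F < 2 m], and then a gap [x] with [m < x < F] would have [F - x < m], so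
    that [F - x] would be a gap as well. For such a pair, the largest gap
    [x > F / 2] with [F - x] a gap is a special gap. *)
Require Import Defs.
From mathcomp Require Import all_boot all_order all_algebra.
From mathcomp Require Import all_classical.
From mathcomp Require Import zify.

Local Open Scope classical_set_scope.

Lemma finite_set_nat_max {A : set nat} :
  finite_set A -> A !=set0 -> exists2 m, A m & forall y, A y -> y <= m.
Proof.
move=> /finite_seqP [X ->] [a Xa].
have leX y : y \in X -> y <= (\max_(i <- X) i)%N.
  by move=> Xy; exact: (leq_bigmax_seq (F := id)).
case: (@ex_maxnP (fun y => y \in X) _ (ex_intro _ a Xa) leX) => m Xm mP.
by exists m.
Qed.

Lemma frobeniusP {S : set nat} {f : nat} :
  frobenius S = f%:Z%R -> ~ S f /\ forall y, f < y -> S y.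
Proof.
(* The default value [- 1] is not a natural number, so the hypothesis forces the gaps to have a
   maximum. *)
rewrite /frobenius; case: xgetP => [z -> [] [x Sx <-] ubx [<-]|//].
split=> // y xy; apply: contrapT => Sy.
have /(_ (Posz y)) := ubx; rewrite lez_nat leqNgt xy => yx.
by have : false by apply: yx; exists y.
Qed.

Lemma multiplicityP {S : set nat} : S `\ 0 !=set0 ->
  [/\ S (multiplicity S), 0 < multiplicity S
    & forall s, S s -> 0 < s -> multiplicity S <= s].
Proof.
move=> [a Sa].
have exP : exists n, `[< (S `\ 0) n >] by exists a; apply/asboolP.
case: (ex_minnP exP) => m /asboolP Pm minm.
have := @xgetPex _ 0 ((S `\ 0) `&` lbound (S `\ 0)).
rewrite -/(multiplicity S) => /(_ _)[].
  by exists m; split => // y Py; apply: minm; apply/asboolP.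
move=> [S_mu mu0] lb_mu; split=> //; first by rewrite lt0n; apply/eqP.
by move=> s Ss s0; apply: lb_mu; split=> // s0'; rewrite s0' in s0.
Qed.

(** The largest element [h] of [A] outside [S] works: [2 * h] and [h + s] lie in [A] and exceed [h],
    hence lie in [S]. *)
Lemma special_gap_in_oversemigroup {S A : set nat} :
  numerical_semigroup S -> numerical_semigroup A -> S `<` A ->
  exists2 h, special_gaps S h & A h.
Proof.
move=> [S0 SD finS] [_ AD _] [SA nAS].
have finAS : finite_set (A `\` S) by apply: sub_finite_set finS => x [].
have neAS : A `\` S !=set0.
  apply: contrapT => AS0; apply: nAS => x Ax; apply: contrapT => Sx.
  by apply: AS0; exists x.
have [h [Ah Sh] maxh] := finite_set_nat_max finAS neAS.
have big y : A y -> h < y -> S y.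
  move=> Ay hy; apply: contrapT => Sy.
  by move: hy; rewrite ltnNge maxh.
have h0 : 0 < h by rewrite lt0n; apply/eqP => h0; apply: Sh; rewrite h0.
exists h => //; split=> //.
  by apply: big; rewrite ?mul2n -?addnn; [exact: AD | lia].
move=> s [Ss /= s0]; apply: big; last by lia.
by apply: AD => //; exact: SA.
Qed.

(** Of two oversemigroups that intersect in [S], one misses the gap [f]; a special gap of [S] inside
    that one differs from [f]. *)
Lemma special_gap_of_not_irreducible {S : set nat} {f : nat} :
  numerical_semigroup S -> ~ irreducible S -> ~ S f ->
  exists2 h, special_gaps S h & h <> f.
Proof.
move=> numS /contrapT [A [B [numA numB SA SB SAB]]] Sf.
have [Af|Af] := pselect (A f); last first.
  have [h hS Ah] := special_gap_in_oversemigroup numS numA SA.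
  by exists h => // hf; apply: Af; rewrite -hf.
have Bf : ~ B f by move=> Bf; apply: Sf; rewrite SAB.
have [h hS Bh] := special_gap_in_oversemigroup numS numB SB.
by exists h => // hf; apply: Bf; rewrite -hf.
Qed.

(** Let [h] be maximal, with partner [k]. If [h + s] were a gap, so would be [k - s], because
    [k = (k - s) + s]; this pair would contradict the maximality of [h]. *)
Lemma special_gap_of_gap_pair {S : set nat} {x y : nat} :
  numerical_semigroup S -> frobenius S = (x + y)%:Z%R ->
  ~ S x -> ~ S y -> y < x ->
  exists h, [/\ special_gaps S h, h <> x + y & x <= h].
Proof.
move=> [S0 SD finS] /frobeniusP [_ bigS] Sx Sy yx.
pose C := [set h | [/\ ~ S h, x <= h & exists2 k, ~ S k & h + k = x + y]].
have finC : finite_set C by apply: sub_finite_set finS => h [].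
have neC : C !=set0 by exists x; split => //; exists y.
have [h [Sh xh [k Sk hk]] maxh] := finite_set_nat_max finC neC.
have k0 : k <> 0 by move=> k0; apply: Sk; rewrite k0.
exists h; split=> //; last by lia.
(* [2 * h] exceeds the Frobenius number [x + y], since [y < x <= h]. *)
split=> //; first by apply: bigS; lia.
move=> s [Ss /= s0]; apply: contrapT => Shs.
(* This bound yields [s <= k], so the truncated subtraction [k - s] is exact. *)
have hsf : h + s <= x + y by rewrite leqNgt; apply/negP => /bigS.
have : h + s <= h; last by lia.
apply: maxh; split=> //; first by lia.
exists (k - s); last by lia.
move=> Sks; apply: Sk; have -> : k = k - s + s by lia.
exact: SD.
Qed.

Theorem theorem3p6 (S : set nat) (numS : numerical_semigroup S)
    (specialS : special S) (nirrS : ~ irreducible S) (nordS : ~ ordinary S) :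
  [set s : nat | multiplicity S <= s /\ (s%:Z < frobenius S)%R] `<=` S.
Proof.
move=> x [/=].
(* No natural number lies below a negative Frobenius number. *)
case Ff : (frobenius S) => [f|//] mx; rewrite ltz_nat => xf.
have [Sf bigS] := frobeniusP Ff.
have [Sm m0 minm] : [/\ S (multiplicity S), 0 < multiplicity S
    & forall s, S s -> 0 < s -> multiplicity S <= s].
  by apply: multiplicityP; exists f.+1; split=> //; apply: bigS.
have pair a b : a + b = f -> ~ S a -> ~ S b -> b < a -> a <= multiplicity S.
  move=> abf Sa Sb ba; rewrite leqNgt; apply/negP => ma.
  have Fab : frobenius S = (a + b)%:Z%R by rewrite abf.
  have [h [hS hf ah]] := special_gap_of_gap_pair numS Fab Sa Sb ba.
  apply: specialS; exists h; split=> //; last lia.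
  by rewrite Ff -abf => -[].
have [h hS hf] := special_gap_of_not_irreducible numS nirrS Sf.
have hm : h <= multiplicity S.
  rewrite leqNgt; apply/negP => mh; apply: specialS; exists h; split=> //.
  by rewrite Ff => -[].
case: hS => Sh S2h Shs.
have lthf : h < f.
  rewrite ltn_neqAle; apply/andP; split; first exact/eqP.
  by rewrite leqNgt; apply/negP => /bigS.
have Sfh : ~ S (f - h).
  move=> Sfh; apply: Sf; have -> : f = h + (f - h) by lia.
  by apply: Shs; split=> //=; lia.
(* The gaps [h] and [f - h] are thus distinct, so [pair] applies to the larger one. *)
have h2f : h.*2 <> f by move=> h2f; apply: Sf; rewrite -h2f -mul2n.
have fhm : f - h <= multiplicity S.
  have [fh|fh] := leqP (f - h) h; first by lia.
  by apply: (pair _ h) => //; lia.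
have fhm' : f - h <> multiplicity S by move=> fhm'; apply: Sfh; rewrite fhm'.
apply: contrapT => Sx.
have xm : x <> multiplicity S by move=> xm; apply: Sx; rewrite xm.
(* From [h <= m] and [f - h < m], with [m] the multiplicity, follows [f < 2 m]. As [m <= x], this
   gives both [0 < f - x < m] and [f - x < x]. *)
have Sfx : ~ S (f - x) by move=> Sfx; have := minm _ Sfx; lia.
suff : x <= multiplicity S by lia.
by apply: (pair _ (f - x)) => //; lia.
Qed.
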